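(* Let $\Phi$ be a twice differentiable, strictly convex, nice Young function. Assume that on $(0,+\infty)$ the function $\Phi(x)/x^2$ is non-decreasing, and the functions $\Phi(x)/x^\theta$ and $\Phi'(x)/x^\eta$ are non-increasing for some $\theta>2$, $\eta>0$. Also assume that there exists $\Gamma\in\mathbb R$ such that for all $x,y\ge0$, $\Gamma\,\Phi(xy)\ge\Phi(x)\Phi(y)$. Let $d\mu(x)=e^{-V(x)}dx$ be a probability measure on $\mathbb R$. Assume that $V$ is of class $\mathcal C^2$ in a neighborhood of $+\infty$ and such that: (i) $\displaystyle\liminf_{x\to+\infty}V'(x)>0$, (ii) $\displaystyle-1<\liminf_{x\to+\infty}\frac{V''(x)}{V'(x)^2}\le\limsup_{x\to+\infty}\frac{V''(x)}{V'(x)^2}<\frac{1}{\max(\theta,\eta)}$, (iii) there exists a constant $\kappa<+\infty$ such that for all locally Lipschitz $f$ on $\mathbb R$, $$\mathbf{Ent}_\mu(f^2)\le\kappa\int_{\mathbb R}H_\Phi\left(\frac{f'}{f}\right)f^2\,d\mu.$$ Then $\displaystyle\limsup_{x\to+\infty}\frac{V(x)}{\Phi(|V'(x)|)}<+\infty$.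
   Context: A nice Young function is an even convex function $\Phi:\mathbb R\to[0,+\infty)$ with $\Phi(0)=0$, $\Phi'(0)=0$, $\lim_{x\to+\infty}\Phi(x)/x=+\infty$, vanishing only at $0$. Its modification is $H_\Phi(x)=x^2$ if $|x|\le1$ and $H_\Phi(x)=\Phi(|x|)/\Phi(1)$ if $|x|>1$. $\mathbf{Ent}_\mu(g)=\int g\log g\,d\mu-(\int g\,d\mu)\log(\int g\,d\mu)$. For a locally Lipschitz $f$, $|f'|(x)=\lim_{r\to0^+}\sup_{|x-y|\le r}\frac{|f(x)-f(y)|}{|x-y|}$, equal almost everywhere to the absolute value of the usual derivative; only $|f'|$ matters since $H_\Phi$ is even. The integrand $H_\Phi(f'/f)f^2$ is read as $0$ at points where $f=0$ (where $f'=0$ almost everywhere). *)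

(* Defs.v *)
From HB Require Import structures.
From mathcomp Require Import all_boot all_order all_algebra.
From mathcomp Require Import all_classical all_reals all_analysis.

Set Implicit Arguments.
Unset Strict Implicit.
Unset Printing Implicit Defensive.

Import Order.TTheory GRing.Theory Num.Theory.
Import numFieldNormedType.Exports.

Local Open Scope classical_set_scope.
Local Open Scope ring_scope.

Record nice_young (R : realType) (Phi : R -> R) : Prop := NiceYoung {
  nice_young_ge0 : forall x, 0 <= Phi x ;
  nice_young_even : forall x, Phi (- x) = Phi x ;
  nice_young_convex : @convex_function R R^o setT Phi ;
  nice_young0 : Phi 0 = 0 ;
  nice_young_deriv0 : is_derive (0 : R) 1 Phi 0 ;
  nice_young_superlinear : Phi x / x @[x --> +oo] --> +oo ;
  nice_young_eq0 : forall x, Phi x = 0 -> x = 0 }.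

Definition strictly_convex (R : realType) (f : R -> R) : Prop :=
  forall x y t : R, x != y -> 0 < t < 1 ->
    f (t * x + (1 - t) * y) < t * f x + (1 - t) * f y.

Definition twice_derivable_at (R : realType) (f : R -> R) (x : R) : Prop :=
  derivable f x 1 /\ derivable f^`()%classic x 1.

Definition C2_near_pinfty (R : realType) (f : R -> R) : Prop :=
  \forall x \near +oo, twice_derivable_at f x /\ {for x, continuous f^`(2)%classic}.

Definition young_modification (R : realType) (Phi : R -> R) (x : R) : R :=
  if `|x| <= 1 then x ^+ 2 else Phi `|x| / Phi 1.

Definition locally_lipschitz (R : realType) (f : R -> R) : Prop :=
  forall x : R, exists2 A : set R, nbhs x A &
    [lipschitz (f : R^o -> R^o) y | y in A].

(* [|f'|(x)], defined at every point when [f] is locally Lipschitz: the real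
   supremum is then finite for small [r], and it is monotone in [r]. *)
Definition abs_deriv (R : realType) (f : R -> R) (x : R) : R :=
  lim (sup [set `|f x - f y| / `|x - y| | y in [set y | 0 < `|x - y| <= r]]
       @[r --> 0^'+]).

(* With [0 * ln 0 = 0]; to be used for [g >= 0] with finite integral, in which
   case the value lies in [0, +oo] when [mu] is a probability. *)
Definition entropy (d : measure_display) (T : measurableType d) (R : realType)
    (mu : set T -> \bar R) (g : T -> R) : \bar R :=
  (\int[mu]_x (g x * ln (g x))%:E
   - (\int[mu]_x (g x)%:E) * lne (\int[mu]_x (g x)%:E))%E.

(* Where [f x = 0], the integrand is [0] because of the factor [f x ^+ 2],
   whatever the value of the quotient. Using [|f'|] instead of [f'] is harmless
   since [young_modification Phi] is even. *)
Definition modified_energy (R : realType) (Phi : R -> R)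
    (mu : set (measurableTypeR R) -> \bar R) (f : R -> R) : \bar R :=
  (\int[mu]_x (young_modification Phi (abs_deriv f x / f x) * f x ^+ 2)%:E)%E.

(* The inequality is required for every locally Lipschitz [f] for which
   [Ent_mu (f^2)] makes sense, i.e. with [f^2] integrable; [Ent_mu (f^2)] and
   the right-hand side may still be [+oo]. *)
Definition modified_log_sobolev (R : realType) (Phi : R -> R)
    (mu : set (measurableTypeR R) -> \bar R) (kappa : R) : Prop :=
  forall f : R -> R, locally_lipschitz f ->
    mu.-integrable setT (fun x : measurableTypeR R => (f x ^+ 2)%:E) ->
    (entropy mu (fun x : measurableTypeR R => f x ^+ 2)%R
     <= kappa%:E * modified_energy Phi mu f)%E.

(* Main.v *)
(** For x large put a = V'(x) and test the modified log-Sobolev inequality with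
    f = max(0, 1 - a|y - x|)^(p+1), where 2(p+1) >= theta.  Since
    (1/V')' = -V''/V'^2 is bounded above by a constant less than 1, V' is at
    most a multiple of a on [x - 1/a, x], so V varies by O(1) there; as V
    increases, the mass of the window [x - 1/a, x + 1/a] and the integral of
    f^2 are both comparable to exp(-V(x)) / a.  If w = max(0, 1 - a|y - x|),
    then |f'|/f = (p+1)a/w, and Phi(a/w) <= w^(-theta) Phi(a), so the energy
    density is O(Phi(a)) and the energy is O(Phi(a) exp(-V(x)) / a).  The entropy
    is at least of order (V(x) + ln a - O(1)) exp(-V(x)) / a; comparing the two
    gives V(x) = O(Phi(a)). *)

Require Import Defs.
From HB Require Import structures.
From mathcomp Require Import all_boot all_order all_algebra.
From mathcomp Require Import all_classical all_reals all_analysis.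
From mathcomp Require Import measurable_realfun ring lra.

Set Implicit Arguments.
Unset Strict Implicit.
Unset Printing Implicit Defensive.

Import Order.TTheory GRing.Theory Num.Theory.
Import numFieldNormedType.Exports.

Local Open Scope classical_set_scope.
Local Open Scope ring_scope.

(** * Lower and upper limits along a filter, and bounds on the local slope *)

Lemma near_lt_limf_einf (R : realType) (T : choiceType) (X : filteredType T)
    (f : X -> \bar R) (F : set_system X) {FF : Filter F} (c : \bar R) :
  (c < limf_einf f F)%E -> \forall x \near F, (c < f x)%E.
Proof.
rewrite limf_einfE => /ereal_sup_gt[_ [A FA <-] cA].
apply: filterS FA => x Ax; apply: (lt_le_trans cA).
by apply: ereal_inf_lbound; exists x.
Qed.

Lemma limf_esup_lt_pinfty (R : realType) (T : choiceType) (X : filteredType T)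
    (f : X -> R) (F : set_system X) {FF : Filter F} (c : R) :
  (\forall x \near F, f x <= c) -> (limf_esup (fun x => (f x)%:E) F < +oo)%E.
Proof.
move=> fc; rewrite limf_esupE; apply: (@le_lt_trans _ _ c%:E); last exact: ltry.
apply: (@le_trans _ _ (ereal_sup ((fun x => (f x)%:E) @` [set x | f x <= c]))).
  by apply: ereal_inf_lbound; exists [set x | f x <= c].
by apply: ge_ereal_sup => _ [x /= fxc <-]; rewrite lee_fin.
Qed.

(** The supremum of the difference quotients is nondecreasing in the radius and, for radii at most
    [r], lies in [[0, L]]. Hence its right limit at [0] exists; this must be known before bounds can
    pass to [lim], which is total. *)
Lemma abs_deriv_bounds (R : realType) (f : R -> R) (x r L : R) :
  0 < r -> (forall y, `|x - y| <= r -> `|f x - f y| <= L * `|x - y|) ->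
  0 <= abs_deriv f x <= L.
Proof.
move=> r0 fL; pose S s := [set `|f x - f y| / `|x - y| |
  y in [set y | 0 < `|x - y| <= s]].
have S0 s : 0 < s -> S s !=set0.
  move=> s0; exists (`|f x - f (x - s)| / `|x - (x - s)|), (x - s) => //=.
  by rewrite subKr gtr0_norm// s0 lexx.
have SL s : s <= r -> ubound (S s) L.
  move=> sr _ [y /= /andP[xy0 xys] <-].
  by rewrite ler_pdivrMr// fL// (le_trans xys).
have supSge0 s : 0 < s -> s <= r -> 0 <= sup (S s).
  move=> s0 sr; have [z Sz] := S0 _ s0.
  apply: (@le_trans _ _ z); last first.
    by apply: ub_le_sup => //; exists L; exact: SL.
  by case: Sz => [y _ <-]; rewrite divr_ge0.
have cS : cvg (sup (S s) @[s --> 0^'+]).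
  apply: nondecreasing_at_right_is_cvgr.
    near=> t => u v; rewrite !in_itv/= => /andP[u0 ut] /andP[v0 vt] uv.
    have vr : v <= r.
      by rewrite (le_trans (ltW vt))//; near: t; exact: nbhs_right_le.
    apply: sup_le; last 2 first.
    - exact: S0.
    - by split; [exact: S0|exists L; exact: SL].
    move=> z [y /= /andP[y0 yu] zE]; exists z; split => //; exists y => //=.
    by rewrite y0 (le_trans yu).
  near=> t; exists 0 => _ [s /= + <-]; rewrite in_itv/= => /andP[s0 st].
  apply: supSge0 => //; rewrite (le_trans (ltW st))//.
  by near: t; exact: nbhs_right_le.
rewrite /abs_deriv; apply/andP; split.
  by apply: limr_ge => //; near=> s; apply: supSge0 => //;
    near: s; exact: nbhs_right_le.
apply: limr_le => //; near=> s; apply: ge_sup; first exact: S0.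
by apply: SL; near: s; exact: nbhs_right_le.
Unshelve. all: by end_near. Qed.

(** * Integrals compared with a constant times a measure *)

(* Unlike [ge0_le_integral], without measurability: [abs_deriv f] is not known
   to be measurable. *)
Lemma ge0_le_integral_nomeasurable d (T : measurableType d) (R : realType)
    (mu : {measure set T -> \bar R}) (D : set T) (f g : T -> \bar R) :
  (forall x, D x -> 0 <= f x)%E -> (forall x, D x -> f x <= g x)%E ->
  (\int[mu]_(x in D) f x <= \int[mu]_(x in D) g x)%E.
Proof.
move=> f0 fg; rewrite !ge0_integralE//; last first.
  by move=> x Dx; rewrite (le_trans (f0 _ Dx))// fg.
apply: ge_ereal_sup => _ [h /= hf <-]; apply: ereal_sup_ubound.
by exists h => //= x; apply: (le_trans (hf x)); exact: lee_restrict.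
Qed.

Lemma integral_le_cst_measure d (T : measurableType d) (R : realType)
    (mu : {measure set T -> \bar R}) (A : set T) (f : T -> R) (c : R) :
  measurable A -> (forall x, 0 <= f x) -> (forall x, A x -> f x <= c) ->
  (forall x, ~ A x -> f x = 0) -> (\int[mu]_x (f x)%:E <= c%:E * mu A)%E.
Proof.
move=> mA f0 fc fA; rewrite -[leRHS](integral_cst mu mA) [leRHS]integral_mkcond.
apply: ge0_le_integral_nomeasurable => [x _|x _]; first by rewrite lee_fin.
rewrite patchE; case: ifPn => [|]; rewrite ?inE ?notin_setE => Ax.
  by rewrite lee_fin fc.
by rewrite fA.
Qed.

Lemma integral_ge_cst_measure d (T : measurableType d) (R : realType)
    (mu : {measure set T -> \bar R}) (A : set T) (f : T -> R) (c : R) :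
  measurable A -> 0 <= c -> (forall x, 0 <= f x) -> (forall x, A x -> c <= f x) ->
  (c%:E * mu A <= \int[mu]_x (f x)%:E)%E.
Proof.
move=> mA c0 f0 fc; rewrite -[leLHS](integral_cst mu mA) [leLHS]integral_mkcond.
apply: ge0_le_integral_nomeasurable => [x _|x _].
  by apply: erestrict_ge0 => *; rewrite lee_fin.
rewrite patchE; case: ifPn => [|]; rewrite ?inE => Ax; rewrite lee_fin//.
exact: fc.
Qed.

(** * Powers of a tent function: Lipschitz bounds and local slope *)

Lemma ler_dist_expn (R : realDomainType) (u v M : R) (p : nat) :
  0 <= u <= M -> 0 <= v <= M ->
  `|u ^+ p.+1 - v ^+ p.+1| <= p.+1%:R * M ^+ p * `|u - v|.
Proof.
move=> /andP[u0 uM] /andP[v0 vM]; have M0 := le_trans u0 uM.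
elim: p => [|p IHp]; first by rewrite !expr1 expr0 !mul1r.
have -> : u ^+ p.+2 - v ^+ p.+2 =
    u * (u ^+ p.+1 - v ^+ p.+1) + (u - v) * v ^+ p.+1 by rewrite !exprS; ring.
rewrite (le_trans (ler_normD _ _))// !normrM (ger0_norm u0).
rewrite (ger0_norm (exprn_ge0 _ v0)).
have -> : p.+2%:R * M ^+ p.+1 * `|u - v| =
    M * (p.+1%:R * M ^+ p * `|u - v|) + `|u - v| * M ^+ p.+1.
  by rewrite -[p.+2%:R]natr1 !exprS; ring.
by apply: lerD; [exact: ler_pM|rewrite ler_wpM2l// lerXn2r// nnegrE].
Qed.

Definition tent (R : realType) (a x y : R) : R := Num.max 0 (1 - a * `|x - y|).

Lemma tent_ge0 (R : realType) (a x y : R) : 0 <= tent a x y.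
Proof. by rewrite /tent le_max lexx. Qed.

Lemma tent_le1 (R : realType) (a x y : R) : 0 < a -> tent a x y <= 1.
Proof. by move=> a0; rewrite /tent ge_max ler01 gerBl mulr_ge0// ltW. Qed.

Lemma tent_eq0 (R : realType) (a x y : R) :
  0 < a -> y \notin `[x - a^-1, x + a^-1] -> tent a x y = 0.
Proof.
move=> a0 ynotin; apply/max_idPl; rewrite subr_le0 -ler_pdivrMl// mulr1 leNgt.
apply: contra ynotin => /ltW; rewrite distrC ler_distl.
by rewrite in_itv.
Qed.

Lemma tent_dist (R : realType) (a x y z : R) :
  0 < a -> `|tent a x y - tent a x z| <= a * `|y - z|.
Proof.
move=> a0.
have h : `|a * `|x - y| - a * `|x - z| | <= a * `|y - z|.
  rewrite -mulrBr normrM (gtr0_norm a0) ler_pM2l//.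
  have -> : y - z = (x - z) - (x - y) by ring.
  by rewrite [leRHS]distrC; exact: ler_dist_dist.
move: h; rewrite /tent; move: (a * _) (a * _) (a * _) => A B D.
rewrite !ler_norml => /andP[h1 h2]; rewrite !maxEle.
by case: ifPn; case: ifPn; rewrite -?ltNge => h3 h4; apply/andP; split; lra.
Qed.

Lemma tentX_dist (R : realType) (a x y z : R) (p : nat) : 0 < a ->
  `|tent a x y ^+ p.+1 - tent a x z ^+ p.+1| <= p.+1%:R * a * `|y - z|.
Proof.
move=> a0; rewrite (@le_trans _ _ (p.+1%:R * 1 ^+ p * `|tent a x y - tent a x z|))//.
  by apply: ler_dist_expn; rewrite tent_ge0 tent_le1.
by rewrite expr1n mulr1 -mulrA ler_wpM2l// tent_dist.
Qed.

Lemma locally_lipschitz_tentX (R : realType) (a x : R) (p : nat) : 0 < a ->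
  locally_lipschitz (fun y => tent a x y ^+ p.+1).
Proof.
move=> a0 y; exists setT; first exact: filterT.
have FF : ProperFilter (globally ([set: R^o] `*` [set: R^o])).
  exact: (@globally_properfilter _ _ (0, 0)).
apply: (@klipschitzW _ _ _ (p.+1%:R * a)) => -[u v] _ /=.
exact: tentX_dist.
Qed.

Lemma measurable_tentX (R : realType) (a x : R) (p : nat) :
  measurable_fun setT (fun y : measurableTypeR R => tent a x y ^+ p).
Proof.
apply: measurable_funX; apply: measurable_maxr; first exact: measurable_cst.
apply: measurable_funB; first exact: measurable_cst.
apply: measurable_funM; first exact: measurable_cst.
apply: measurableT_comp; first exact: normr_measurable.
by apply: measurable_funB => //; exact: measurable_cst.
Qed.

(** The tent has slope at most [a], so within distance [tent a x y / a] of [y] it at most doubles.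
    Bounding the power difference with [M = 2 * tent a x y] costs the factor [2 ^+ p] but keeps
    [tent a x y ^+ p], so that dividing by the tent to the power [p.+1] leaves a multiple of
    [a / tent a x y]. *)
Lemma abs_deriv_tentX (R : realType) (a x y : R) (p : nat) :
  0 < a -> 0 < tent a x y ->
  0 <= abs_deriv (fun z => tent a x z ^+ p.+1) y <=
    p.+1%:R * 2 ^+ p * a * tent a x y ^+ p.
Proof.
move=> a0 t0; apply: (@abs_deriv_bounds _ _ _ (tent a x y / a)).
  exact: divr_gt0.
move=> z yz; have := tent_dist x y z a0 => tyz.
have tz : tent a x z <= 2 * tent a x y.
  move: yz; rewrite ler_pdivlMr// mulrC => yz.
  by move: (le_trans tyz yz); rewrite ler_norml => /andP[? ?]; lra.
apply: le_trans (ler_dist_expn p (M := 2 * tent a x y) _ _) _.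
- by rewrite tent_ge0/=; lra.
- by rewrite tent_ge0.
rewrite exprMn; set q := tent a x y ^+ p.
have q0 : 0 <= q by exact/exprn_ge0/ltW.
rewrite [leRHS](_ : _ = p.+1%:R * (2 ^+ p * q) * (a * `|y - z|)); last by ring.
by rewrite ler_wpM2l// !mulr_ge0// exprn_ge0.
Qed.

(** * Growth of the Young function and the energy density of a tent power *)

Lemma young_gt0 (R : realType) (Phi : R -> R) (x : R) :
  nice_young Phi -> 0 < x -> 0 < Phi x.
Proof.
move=> PhiY x0; rewrite lt0r (nice_young_ge0 PhiY) andbT.
by apply: contraTneq x0 => /(nice_young_eq0 PhiY) ->; rewrite ltxx.
Qed.

Lemma young_le (R : realType) (Phi : R -> R) (x y : R) : nice_young Phi ->
  {in `]0, +oo[ &, {homo (fun x : R => Phi x / x ^+ 2) :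
    x y / x <= y >-> x <= y}} ->
  0 < x -> x <= y -> Phi x <= Phi y.
Proof.
move=> PhiY Phi_sq x0 xy; have y0 := lt_le_trans x0 xy.
have := Phi_sq x y; rewrite !in_itv/= !andbT => /(_ x0 y0 xy).
rewrite ler_pdivrMr ?exprn_gt0// => /le_trans; apply.
rewrite mulrAC ler_pdivrMr ?exprn_gt0// ler_wpM2l ?(nice_young_ge0 PhiY)//.
by rewrite lerXn2r ?nnegrE ?(ltW x0) ?(ltW y0).
Qed.

(** Comparing [Phi x / x^theta] at [a] and [l * a] gives the factor [l^theta]. As [l >= 1], it may
    be raised to a natural power, which can later cancel against a power of the tent. *)
Lemma young_scale_le (R : realType) (Phi : R -> R) (theta a l : R) (n : nat) :
  nice_young Phi ->
  {in `]0, +oo[ &, {homo (fun x : R => Phi x / x `^ theta) :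
    x y / x <= y >-> y <= x}} ->
  theta <= n%:R -> 0 < a -> 1 <= l -> Phi (l * a) <= l ^+ n * Phi a.
Proof.
move=> PhiY Phi_theta thn a0 l1; have l0 : 0 < l := lt_le_trans ltr01 l1.
have la0 : 0 < l * a by exact: mulr_gt0.
have := Phi_theta a (l * a); rewrite !in_itv/= !andbT => /(_ a0 la0).
rewrite ler_peMl ?(ltW a0)// => /(_ isT).
rewrite ler_pdivrMr ?powR_gt0// => /le_trans; apply.
rewrite powRM ?(ltW a0) ?(ltW l0)// mulrA mulrAC.
rewrite divfK ?gt_eqF ?powR_gt0// mulrC.
rewrite -powR_mulrn ?(ltW l0)// ler_wpM2r ?(nice_young_ge0 PhiY)//.
exact: ler_powR.
Qed.

Lemma young_modification_ge0 (R : realType) (Phi : R -> R) (x : R) :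
  nice_young Phi -> 0 <= young_modification Phi x.
Proof.
move=> PhiY; rewrite /young_modification; case: ifPn => _.
  exact: sqr_ge0.
by rewrite divr_ge0 ?(nice_young_ge0 PhiY).
Qed.

(** The two summands serve the two branches. If [z <= 1], then [z^2 <= u^2], and
    [u^2 / Phi u <= e^2 / Phi e] since [Phi x / x^2] is nondecreasing. Otherwise
    [Phi z <= Phi u]. *)
Lemma young_modification_le (R : realType) (Phi : R -> R) (e u z : R) :
  nice_young Phi ->
  {in `]0, +oo[ &, {homo (fun x : R => Phi x / x ^+ 2) :
    x y / x <= y >-> x <= y}} ->
  0 < e -> e <= u -> 0 <= z -> z <= u ->
  young_modification Phi z <= (e ^+ 2 / Phi e + (Phi 1)^-1) * Phi u.
Proof.
move=> PhiY Phi_sq e0 eu z0 zu; have u0 := lt_le_trans e0 eu.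
rewrite mulrDl /young_modification ger0_norm//; case: ifPn => z1.
  apply: ler_wpDr.
    by rewrite mulr_ge0 ?invr_ge0 ?(nice_young_ge0 PhiY).
  apply: (@le_trans _ _ (u ^+ 2)); first by rewrite lerXn2r ?nnegrE ?(ltW u0).
  have := Phi_sq e u; rewrite !in_itv/= !andbT => /(_ e0 u0 eu).
  rewrite ler_pdivlMr ?exprn_gt0// mulrAC ler_pdivrMr ?exprn_gt0// => h.
  by rewrite mulrAC ler_pdivlMr ?young_gt0// mulrC (le_trans h)// mulrC.
apply: ler_wpDl.
  by rewrite !mulr_ge0 ?(ltW e0) ?invr_ge0 ?(nice_young_ge0 PhiY).
rewrite mulrC ler_wpM2l ?invr_ge0 ?(nice_young_ge0 PhiY)//.
by apply: young_le => //; apply: lt_trans (ltr01) _; rewrite ltNge.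
Qed.

(** With [w] the tent at [y], the quotient is at most [k * a / w], and scaling gives
    [Phi (k / w * a) <= (k / w)^n * Phi a] for [n = 2(p+1)]. The singular factor [w^(-n)] cancels
    exactly against the squared test function [w^n]; this dictates the choice of [p]. *)
Lemma young_tentX_le (R : realType) (Phi : R -> R) (theta e a x y : R)
    (p : nat) :
  nice_young Phi ->
  {in `]0, +oo[ &, {homo (fun x : R => Phi x / x ^+ 2) :
    x y / x <= y >-> x <= y}} ->
  {in `]0, +oo[ &, {homo (fun x : R => Phi x / x `^ theta) :
    x y / x <= y >-> y <= x}} ->
  theta <= (p.+1 * 2)%:R -> 0 < e -> e <= a ->
  young_modification Phi
      (abs_deriv (fun z => tent a x z ^+ p.+1) y / tent a x y ^+ p.+1) *
    (tent a x y ^+ p.+1) ^+ 2 <=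
  (e ^+ 2 / Phi e + (Phi 1)^-1) * (p.+1%:R * 2 ^+ p) ^+ (p.+1 * 2) * Phi a.
Proof.
move=> PhiY Phi_sq Phi_theta thp e0 ea; have a0 := lt_le_trans e0 ea.
pose f z := tent a x z ^+ p.+1; rewrite -[fun z => _]/f -/(f y).
set C := _ + _; set k := p.+1%:R * 2 ^+ p.
have C0 : 0 <= C.
  by rewrite addr_ge0 ?divr_ge0 ?invr_ge0 ?sqr_ge0 ?(nice_young_ge0 PhiY).
have k1 : 1 <= k by rewrite /k mulr_ege1 ?ler1n ?exprn_ege1 ?ler1n.
have k0 : 0 < k := lt_le_trans ltr01 k1.
have [t0|t0] := ltP 0 (tent a x y); last first.
  have -> : f y = 0.
    by rewrite /f (le_anti (introT andP (conj t0 (tent_ge0 a x y)))) expr0n.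
  rewrite expr0n/= mulr0 mulr_ge0 ?(nice_young_ge0 PhiY)//.
  by apply: mulr_ge0 => //; apply/exprn_ge0/ltW.
have /andP[D0 Dle] := abs_deriv_tentX p a0 t0.
set w := tent a x y in t0 Dle *.
have w1 : w <= 1 by exact: tent_le1.
have f0 : 0 < f y by exact: exprn_gt0.
have kw1 : 1 <= k / w by rewrite ler_pdivlMr// mul1r (le_trans w1).
apply: (@le_trans _ _ (C * Phi (k / w * a) * f y ^+ 2)).
  apply: ler_wpM2r; first exact: sqr_ge0.
  apply: young_modification_le => //.
  - by rewrite (le_trans ea)// ler_peMl// ltW.
  - by rewrite divr_ge0// ltW.
  - rewrite ler_pdivrMr// (le_trans Dle)// /f -/w -/k exprS le_eqVlt; apply/orP; left.
    by apply/eqP; field; rewrite gt_eqF.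
rewrite -!(mulrA C); apply: ler_wpM2l => //.
have := young_scale_le PhiY Phi_theta thp a0 kw1 => h.
apply: le_trans (ler_wpM2r (sqr_ge0 _) h) _.
rewrite /f -/w -exprM expr_div_n le_eqVlt; apply/orP; left; apply/eqP.
by field; rewrite gt_eqF// exprn_gt0.
Qed.

(** * Growth of the potential [V] far out *)

Lemma ereal_real_between (R : realType) (r : R) (l : \bar R) :
  (r%:E < l)%E -> exists2 s, r < s & (s%:E < l)%E.
Proof.
case: l => [l| |]//; rewrite ?lte_fin => rl;
  last by exists (r + 1); rewrite ?ltry ?ltrDl.
by exists ((r + l) / 2); rewrite ?lte_fin midf_lt.
Qed.

Lemma MVT_derive1 (R : realType) (f : R -> R) (a b : R) : a <= b ->
  (forall y, a <= y <= b -> derivable f y 1) ->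
  exists2 c, a <= c <= b & f b - f a = f^`()%classic c * (b - a).
Proof.
move=> ab df; have [y yab|y|c cab E] := @MVT_segment R f f^`()%classic a b ab.
- split; last by rewrite derive1E.
  by apply: df; move: yab; rewrite in_itv/= => /andP[/ltW-> /ltW->].
- apply: derivable_within_continuous => z; rewrite in_itv/= => zab; exact: df.
by exists c.
Qed.

Section well_potential.
Variables (R : realType) (V : R -> R) (M e q : R).
Hypotheses (e0 : 0 < e) (q0 : 0 < q) (q1 : q <= 1).
Hypothesis V_twice : forall y, M < y -> twice_derivable_at V y.
Hypothesis V'_gt : forall y, M < y -> e < V^`()%classic y.
Hypothesis V''_gt : forall y, M < y ->
  q - 1 < V^`(2)%classic y / V^`()%classic y ^+ 2.

Lemma potential_le (y z : R) : M < y -> y <= z -> V y <= V z.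
Proof.
move=> My yz; have [|c /andP[yc _] Vyz] := MVT_derive1 (f := V) yz.
  by move=> t /andP[yt _]; have [] := V_twice (lt_le_trans My yt).
rewrite -subr_ge0 Vyz mulr_ge0 ?subr_ge0// ltW// (lt_trans e0)// V'_gt//.
exact: lt_le_trans My yc.
Qed.

(** The derivative [-V''/V'^2] of [1/V'] is less than [1 - q]. With [a = V'(x)], going back from [x]
    by at most [1/a] therefore lowers [1/V'] by at most [(1 - q)/a], which leaves at least [q/a]. *)
Lemma deriv_potential_le (x y : R) :
  M < y -> y <= x -> x - (V^`()%classic x)^-1 <= y ->
  V^`()%classic y <= V^`()%classic x / q.
Proof.
move=> My yx ya; set a := V^`()%classic x.
have V'0 t : y <= t -> 0 < V^`()%classic t.
  by move=> yt; rewrite (lt_trans e0)// V'_gt// (lt_le_trans My yt).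
pose g (s : R) : R := (V^`()%classic s)^-1.
have dV t : y <= t -> is_derive t 1 g
    (- (V^`()%classic t) ^- 2 *: V^`(2)%classic t).
  move=> yt; apply: is_deriveV; first by rewrite gt_eqF// V'0.
  have [_ V2] := V_twice (lt_le_trans My yt).
  by split; [exact: V2|rewrite -derive1E].
have [|c /andP[yc _] ] := MVT_derive1 (f := g) yx.
  by move=> t /andP[/dV[]].
rewrite derive1E (@derive_val _ _ _ _ _ _ _ (dV _ yc)) /g -/a scaleNr => E.
have := V''_gt (lt_le_trans My yc).
rewrite mulrC; move: E; rewrite /GRing.scale/=; set d := _^-1 * _ => E d1.
have a0 : 0 < a by exact: V'0.
have b0 := V'0 _ (lexx y); set b := V^`()%classic y in E b0 *.
have h : (x - y) * (1 - q) <= a^-1 * (1 - q).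
  by rewrite ler_wpM2r ?subr_ge0// -/a; move: ya; rewrite -/a; lra.
have h2 : - d * (x - y) <= (1 - q) * (x - y).
  by rewrite ler_wpM2r ?subr_ge0//; lra.
have h3 : a^-1 * q <= b^-1 by lra.
rewrite ler_pdivlMr//; have := ler_wpM2l (ltW (mulr_gt0 a0 b0)) h3.
rewrite mulfK ?gt_eqF// (_ : _ * (_ * q) = b * q)//.
by field; rewrite gt_eqF.
Qed.

(** By the mean value theorem [V] increases by at most [(a/q) * (1/a) = 1/q] on [[x - 1/a, x]];
    monotonicity extends the lower bound to everything on the right. No upper bound is claimed
    beyond [x]. *)
Lemma potential_window (x : R) : M < x - e^-1 ->
  let a := V^`()%classic x in
  (forall y, x - a^-1 <= y -> V x - q^-1 <= V y) /\
  (forall y, x - a^-1 <= y -> y <= x -> V y <= V x).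
Proof.
move=> Mx a.
have Mx' : M < x by rewrite (lt_trans Mx)// gtrBl invr_gt0.
have ea : e < a by exact: V'_gt.
have a0 : 0 < a := lt_trans e0 ea.
(* Since [e < a], the left end of the window stays in the region where the hypotheses on [V]
   hold. *)
have Ma : M < x - a^-1 by rewrite (lt_trans Mx)// ltrD2l ltrN2 ltf_pV2.
have ax : x - a^-1 <= x by rewrite gerBl invr_ge0 ltW.
have h y : x - a^-1 <= y -> V (x - a^-1) <= V y by exact: potential_le.
split=> y ay; last by apply: potential_le; exact: lt_le_trans Ma ay.
apply: le_trans (h _ ay).
have [|c /andP[ac cx] E] := MVT_derive1 (f := V) ax.
  by move=> t /andP[at_ _]; have [] := V_twice (lt_le_trans Ma at_).
have := deriv_potential_le (lt_le_trans Ma ac) cx ac.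
rewrite -/a => cq; rewrite lerBlDl -lerBlDr E subKr.
rewrite (le_trans (ler_wpM2r _ cq)) ?invr_ge0 ?(ltW a0)//.
by rewrite mulrAC divff ?gt_eqF// mul1r.
Qed.

End well_potential.

(** * Mass of an interval from bounds on the potential *)

Section density.
Variables (R : realType) (V : R -> R) (mu : probability (measurableTypeR R) R).
Hypothesis mu_density : forall A : set (measurableTypeR R), measurable A ->
  mu A = (\int[lebesgue_measure]_(x in A) (expR (- V x))%:E)%E.

Lemma density_itv_le (u v c : R) : u < v ->
  (forall y, u <= y <= v -> c <= V y) ->
  (mu `[u, v]%classic <= (expR (- c) * (v - u))%:E)%E.
Proof.
move=> uv cV; rewrite mu_density//.
have -> : (expR (- c) * (v - u))%:E =
    (\int[lebesgue_measure]_(x in `[u, v]) cst (expR (- c))%:E x)%E.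
  by rewrite integral_cst//= lebesgue_measure_itv/= lte_fin uv -EFinB -EFinM.
apply: ge0_le_integral_nomeasurable => y; first by rewrite lee_fin expR_ge0.
by rewrite /= in_itv/= => /cV cVy; rewrite lee_fin ler_expR lerN2.
Qed.

Lemma density_itv_ge (u v c : R) : u < v ->
  (forall y, u <= y <= v -> V y <= c) ->
  ((expR (- c) * (v - u))%:E <= mu `[u, v]%classic)%E.
Proof.
move=> uv cV; rewrite mu_density//.
have -> : (expR (- c) * (v - u))%:E =
    (\int[lebesgue_measure]_(x in `[u, v]) cst (expR (- c))%:E x)%E.
  by rewrite integral_cst//= lebesgue_measure_itv/= lte_fin uv -EFinB -EFinM.
apply: ge0_le_integral_nomeasurable => y; first by rewrite lee_fin expR_ge0.
by rewrite /= in_itv/= => /cV cVy; rewrite lee_fin ler_expR lerN2.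
Qed.

End density.

(** * Lower bounds for the entropy *)

Lemma mulr_ln_ge (R : realType) (t : R) : 0 <= t -> -1 <= t * ln t.
Proof.
rewrite le_eqVlt => /orP[/eqP <-|t0]; first by rewrite mul0r lerN10.
have := ln_sublinear (x := t^-1); rewrite invr_gt0 => /(_ t0).
rewrite lnV ?posrE// => /ltW; rewrite -(ler_pM2l t0) divff ?gt_eqF// mulrN => h.
by rewrite lerNl.
Qed.

(** On [W] the integrand [g ln g] is at least [-1], and outside [W] it vanishes, so its integral is
    at least [- mu W]. *)
Lemma entropy_ge d (T : measurableType d) (R : realType)
    (mu : {measure set T -> \bar R}) (W : set T) (g : T -> R) (m : R) :
  measurable W -> (forall x, 0 <= g x <= 1) -> (forall x, ~ W x -> g x = 0) ->
  (\int[mu]_x (g x)%:E)%E = m%:E -> 0 < m ->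
  (- mu W - (m * ln m)%:E <= entropy mu g)%E.
Proof.
move=> mW g01 gW gm m0; rewrite /entropy gm lne_EFin// -EFinM.
apply: leeB => //.
have h x : 0 <= - (g x * ln (g x)).
  have /andP[g0 g1] := g01 x; rewrite -mulrN mulr_ge0// oppr_ge0; exact: ln_le0.
(* As [g <= 1], the function [- g ln g] is nonnegative, so the comparison of nonnegative integrals
   applies to it. *)
have -> : (\int[mu]_x (g x * ln (g x))%:E =
    - \int[mu]_x (- (g x * ln (g x)))%:E)%E.
  rewrite -integral_ge0N; last by move=> x _; rewrite lee_fin.
  by apply: eq_integral => x _; rewrite -EFinN opprK.
rewrite leeN2 -[leRHS]mul1e; apply: integral_le_cst_measure => //.
- by move=> x _; rewrite lerNl; have /andP[g0 _] := g01 x; exact: mulr_ln_ge.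
- by move=> x /gW ->; rewrite mul0r oppr0.
Qed.

(** Here [m] is the integral of the squared test function, enclosed between [B] and [A]. From
    [ln m <= -D] follows [m * D <= A * Q]; replacing [m] by [B] requires [D > 0], and for [D <= 0]
    the bound is trivial. *)
Lemma log_mass_bound (R : realType) (m A B D Q : R) :
  0 < B -> B <= m -> m <= A -> ln A = - D -> 0 <= Q ->
  - (m * ln m) <= A * Q -> D <= A / B * Q.
Proof.
move=> B0 Bm mA lnA Q0 mQ; have m0 := lt_le_trans B0 Bm.
have A0 := lt_le_trans m0 mA.
have [D0|D0] := leP D 0.
  by rewrite (le_trans D0)// !mulr_ge0// ?invr_ge0 ltW.
have lnm : ln m <= - D by rewrite -lnA ler_ln.
rewrite mulrAC ler_pdivlMr// mulrC (le_trans _ mQ)//.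
rewrite (@le_trans _ _ (m * D))//; first by rewrite ler_wpM2r// ltW.
by rewrite -mulrN ler_pM2l// lerNr.
Qed.

(** * The tent power tested at a single point [x] *)

(** [K] bounds the drop of [V] below [V x] on the window. On the right-hand side only [Phi a] varies
    with the position of [x], which makes the estimate uniform. *)
Lemma modified_log_sobolev_potential_le (R : realType) (Phi : R -> R)
    (theta kappa : R) (V : R -> R) (mu : probability (measurableTypeR R) R)
    (p : nat) (e a x K : R) :
  nice_young Phi ->
  {in `]0, +oo[ &, {homo (fun x : R => Phi x / x ^+ 2) :
    x y / x <= y >-> x <= y}} ->
  {in `]0, +oo[ &, {homo (fun x : R => Phi x / x `^ theta) :
    x y / x <= y >-> y <= x}} ->
  (forall A : set (measurableTypeR R), measurable A ->
    mu A = (\int[lebesgue_measure]_(x in A) (expR (- V x))%:E)%E) ->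
  modified_log_sobolev Phi mu kappa ->
  theta <= (p.+1 * 2)%:R -> 0 < e -> e <= a ->
  (forall y, x - a^-1 <= y -> V x - K <= V y) ->
  (forall y, x - a^-1 <= y -> y <= x -> V y <= V x) ->
  V x <= K + ln (2 / e) + 2 ^+ (p.+1 * 2).+2 * expR K *
    (1 + `|kappa| * ((e ^+ 2 / Phi e + (Phi 1)^-1) *
                     (p.+1%:R * 2 ^+ p) ^+ (p.+1 * 2) * Phi a)).
Proof.
move=> PhiY Phi_sq Phi_theta mu_density MLS thp e0 ea VK Vx.
have a0 := lt_le_trans e0 ea; have ai0 : 0 < a^-1 by rewrite invr_gt0.
set n := (p.+1 * 2)%N; set P := _ * Phi a.
pose f y := tent a x y ^+ p.+1.
pose W : set (measurableTypeR R) := `[x - a^-1, x + a^-1]%classic.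
have mW : measurable W by exact: measurable_itv.
have fW y : ~ W y -> f y = 0.
  by move=> Wy; rewrite /f tent_eq0 ?expr0n//; apply/negP.
have f01 y : 0 <= f y ^+ 2 <= 1.
  by rewrite sqr_ge0 -exprM exprn_ile1 ?tent_ge0 ?tent_le1.
have P0 : 0 <= P.
  by have := young_tentX_le x x PhiY Phi_sq Phi_theta thp e0 ea;
    apply: le_trans; rewrite mulr_ge0 ?sqr_ge0 ?young_modification_ge0.
(* Largest density on the window, times its length [2 / a]. *)
pose A := expR (K - V x) * (2 / a).
have WA : (mu W <= A%:E)%E.
  have -> : A = expR (- (V x - K)) * (x + a^-1 - (x - a^-1)).
    by rewrite /A opprB; congr (_ * _); ring.
  apply: (density_itv_le mu_density).
    by rewrite (@lt_trans _ _ x) ?ltrDl ?gtrBl.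
  by move=> y /andP[/VK].
(* On [U] the tent is at least [1/2]. Only points left of [x] are taken, because [V] is bounded
   above by [V x] only there. *)
pose U : set (measurableTypeR R) := `[x - (2 * a)^-1, x]%classic.
have mU : measurable U by exact: measurable_itv.
have UA : ((expR (- V x) * (2 * a)^-1)%:E <= mu U)%E.
  have -> : (2 * a)^-1 = x - (x - (2 * a)^-1) by ring.
  apply: (density_itv_ge mu_density); first by rewrite gtrBl invr_gt0 mulr_gt0.
  move=> y /andP[yl yr]; apply: Vx => //; apply: le_trans yl.
  by rewrite lerD2l lerN2 lef_pV2 ?posrE ?mulr_gt0// ler_peMl ?ler1n// ltW.
have fU (y : R) : U y -> 2^-1 ^+ n <= f y ^+ 2.
  rewrite /U/= in_itv/= => /andP[yl yr].
  rewrite /f -exprM lerXn2r ?nnegrE ?tent_ge0//.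
  rewrite /tent le_max; apply/orP; right.
  rewrite ger0_norm ?subr_ge0//.
  have : a * (x - y) <= a * (2 * a)^-1.
    by rewrite ler_pM2l// lerBlDr -lerBlDl.
  have -> : a * (2 * a)^-1 = 2^-1 by field; rewrite gt_eqF.
  by lra.
pose B := 2^-1 ^+ n * (expR (- V x) * (2 * a)^-1).
have B0 : 0 < B.
  apply: mulr_gt0; first by rewrite exprn_gt0// invr_gt0.
  by rewrite mulr_gt0 ?expR_gt0// invr_gt0 mulr_gt0.
have f_le : (\int[mu]_y (f y ^+ 2)%:E <= mu W)%E.
  rewrite -[leRHS]mul1e; apply: integral_le_cst_measure => //.
  - by move=> y; have /andP[] := f01 y.
  - by move=> y _; have /andP[] := f01 y.
  - by move=> y /fW ->; rewrite expr0n.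
have f_ge : (B%:E <= \int[mu]_y (f y ^+ 2)%:E)%E.
  apply: (@le_trans _ _ ((2^-1 ^+ n)%:E * mu U)%E).
    by rewrite /B EFinM lee_wpmul2l// lee_fin exprn_ge0.
  by apply: integral_ge_cst_measure => //= y; have /andP[] := f01 y.
have W_fin : mu W \is a fin_num by exact: fin_num_measure.
have [m fm] : exists m, (\int[mu]_y (f y ^+ 2)%:E)%E = m%:E.
  exists (fine (\int[mu]_y (f y ^+ 2)%:E)%E); rewrite fineK//.
  rewrite ge0_fin_numE.
    by rewrite (le_lt_trans f_le)// -ge0_fin_numE.
  by rewrite (le_trans _ f_ge)// lee_fin ltW.
have [w ww] : exists w, mu W = w%:E by exists (fine (mu W)); rewrite fineK.
rewrite fm in f_ge f_le; rewrite ww !lee_fin in WA f_le f_ge.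
have m0 : 0 < m := lt_le_trans B0 f_ge.
have mf : measurable_fun setT (fun y : measurableTypeR R => f y ^+ 2).
  by apply: measurable_funX; exact: measurable_tentX.
have intf : mu.-integrable setT (fun y : measurableTypeR R => (f y ^+ 2)%:E).
  apply/integrableP; split; first exact/measurable_EFinP.
  under eq_integral => y _ do rewrite gee0_abs ?lee_fin ?sqr_ge0//.
  by rewrite fm ltry.
have f2W y : ~ W y -> f y ^+ 2 = 0 by move/fW => ->; rewrite expr0n.
have ent_ge := entropy_ge mW f01 f2W fm m0.
have ent_le := MLS f (locally_lipschitz_tentX x p a0) intf.
have en_ge0 : (0 <= modified_energy Phi mu f)%E.
  apply: integral_ge0 => y _.
  by rewrite lee_fin mulr_ge0 ?sqr_ge0 ?young_modification_ge0.
have en_le : (modified_energy Phi mu f <= P%:E * mu W)%E.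
  apply: integral_le_cst_measure => //.
  - by move=> y; rewrite mulr_ge0 ?sqr_ge0 ?young_modification_ge0.
  - by move=> y _; exact: young_tentX_le Phi_theta thp e0 ea.
  - by move=> y /fW fy; rewrite fy expr0n mulr0.
(* The sign of [kappa] is unknown; with its absolute value the upper bound on the energy can be
   multiplied through. *)
have : (- mu W - (m * ln m)%:E <= `|kappa|%:E * (P%:E * mu W))%E.
  apply: (le_trans ent_ge); apply: (le_trans ent_le).
  apply: (@le_trans _ _ (`|kappa|%:E * modified_energy Phi mu f)%E).
    by rewrite lee_wpmul2r// lee_fin ler_norm.
  by rewrite lee_wpmul2l// lee_fin.
rewrite ww -EFinN -EFinB -!EFinM lee_fin => mw.
have Q0 : 0 <= 1 + `|kappa| * P by rewrite addr_ge0// mulr_ge0.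
(* The summand [1] absorbs the term [mu W] lost in the entropy bound. *)
have mA : - (m * ln m) <= A * (1 + `|kappa| * P).
  apply: (@le_trans _ _ (w * (1 + `|kappa| * P))); first by lra.
  exact: ler_wpM2r.
have lnA : ln A = - (V x - K - ln (2 / a)).
  rewrite /A lnM ?posrE ?expR_gt0 ?divr_gt0// expRK; ring.
have := log_mass_bound B0 f_ge (le_trans f_le WA) lnA Q0 mA.
(* The factors [exp(-V x)] and [1/a] cancel, so the ratio does not depend on [x]. *)
have -> : A / B = 2 ^+ n.+2 * expR K.
  rewrite /A /B expRD !exprS exprVn.
  by field; rewrite !gt_eqF ?expR_gt0 ?exprn_gt0.
have : ln (2 / a) <= ln (2 / e).
  by rewrite ler_ln ?posrE ?divr_gt0// ler_pM2l// lef_pV2.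
by lra.
Qed.

(** * Uniform constants and conclusion *)

Theorem theorem26 (R : realType) (Phi : R -> R) (theta eta : R)
    (V : R -> R) (mu : probability (measurableTypeR R) R)
    (Phi_nice : nice_young Phi)
    (Phi_twice : forall x : R, twice_derivable_at Phi x)
    (Phi_strict : strictly_convex Phi)
    (theta_gt2 : 2 < theta) (eta_gt0 : 0 < eta)
    (Phi_sq : {in `]0, +oo[ &, {homo (fun x : R => Phi x / x ^+ 2) :
                 x y / x <= y >-> x <= y}})
    (Phi_theta : {in `]0, +oo[ &, {homo (fun x : R => Phi x / x `^ theta) :
                 x y / x <= y >-> y <= x}})
    (Phi_eta : {in `]0, +oo[ &, {homo (fun x : R => Phi^`()%classic x / x `^ eta) :
                 x y / x <= y >-> y <= x}})
    (Phi_mul : exists Gamma : R, forall x y : R, 0 <= x -> 0 <= y ->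
                 Phi x * Phi y <= Gamma * Phi (x * y))
    (V_meas : measurable_fun setT (V : measurableTypeR R -> measurableTypeR R))
    (mu_density : forall A : set (measurableTypeR R), measurable A ->
       mu A = (\int[lebesgue_measure]_(x in A) (expR (- V x))%:E)%E)
    (V_C2 : C2_near_pinfty V)
    (V_i : (0 < limf_einf (fun x : R => (V^`()%classic x)%:E) +oo%R)%E)
    (V_ii_inf : ((-1)%:E <
       limf_einf (fun x : R => (V^`(2)%classic x / V^`()%classic x ^+ 2)%:E) +oo%R)%E)
    (V_ii_sup :
       (limf_esup (fun x : R => (V^`(2)%classic x / V^`()%classic x ^+ 2)%:E) +oo%R
        < ((Num.max theta eta)^-1)%:E)%E)
    (V_iii : exists kappa : R, modified_log_sobolev Phi mu kappa) :
  (limf_esup (fun x : R => (V x / Phi `|V^`()%classic x|)%:E) +oo%R < +oo)%E.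
Proof.
have [kappa MLS] := V_iii.
(* Both lower limits may be infinite; real numbers strictly below them bound the functions
   eventually. *)
have [e e0 V'inf] := ereal_real_between V_i.
have [s s1 V''inf] := ereal_real_between V_ii_inf.
(* [s > -1] makes [q] positive, and the cap at [1] keeps [1 - q] nonnegative while [q - 1 <= s]
   still holds. *)
pose q := Num.min (1 + s) 1.
have q0 : 0 < q by rewrite /q lt_min ltr01 andbT; lra.
have q1 : q <= 1 by rewrite /q ge_min lexx orbT.
have qs : q - 1 <= s by rewrite lerBlDl /q ge_min lexx.
have V'gt : \forall y \near +oo, (e%:E < (V^`()%classic y)%:E)%E.
  exact: near_lt_limf_einf V'inf.
have V''gt : \forall y \near +oo,
    (s%:E < (V^`(2)%classic y / V^`()%classic y ^+ 2)%:E)%E.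
  exact: near_lt_limf_einf V''inf.
have [M [_ HM]] : \forall y \near +oo, [/\ twice_derivable_at V y,
    e < V^`()%classic y & q - 1 < V^`(2)%classic y / V^`()%classic y ^+ 2].
  apply: filterS (filterI V_C2 (filterI V'gt V''gt)) => y [[Vty _] [V'y V''y]]; split => //.
  exact: le_lt_trans qs _.
have Vt y : M < y -> twice_derivable_at V y by case/HM.
have V1 y : M < y -> e < V^`()%classic y by case/HM.
have V2 y : M < y -> q - 1 < V^`(2)%classic y / V^`()%classic y ^+ 2 by case/HM.
pose p := Num.truncn theta.
have thp : theta <= (p.+1 * 2)%:R.
  by rewrite (le_trans (ltW (truncnS_gt theta)))// ler_nat leq_pmulr.
pose C1 := q^-1 + ln (2 / e).
pose C2 := 2 ^+ (p.+1 * 2).+2 * expR q^-1.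
pose C3 := `|kappa| * ((e ^+ 2 / Phi e + (Phi 1)^-1) *
  (p.+1%:R * 2 ^+ p) ^+ (p.+1 * 2)).
(* [C1] may be negative, hence the absolute value; [Phi a >= Phi e > 0] then bounds the constant
   term divided by [Phi a]. *)
suff : \forall x \near +oo,
    V x / Phi `|V^`()%classic x| <= `|C1 + C2| / Phi e + C2 * C3.
  exact: limf_esup_lt_pinfty.
near=> x.
have Mx : M < x - e^-1.
  by rewrite ltrBrDr; near: x; apply: nbhs_pinfty_gt; exact: num_real.
have Mx' : M < x by rewrite (lt_trans Mx)// gtrBl invr_gt0.
have ea := V1 _ Mx'; set a := V^`()%classic x in ea *.
have a0 := lt_trans e0 ea.
have [VK Vx] := potential_window e0 q0 q1 Vt V1 V2 Mx.
have := modified_log_sobolev_potential_le Phi_nice Phi_sq Phi_theta mu_density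
  MLS thp e0 (ltW ea) VK Vx.
rewrite -/C1 -/C2 (gtr0_norm a0).
have Pa0 := young_gt0 Phi_nice a0; have Pe0 := young_gt0 Phi_nice e0.
rewrite ler_pdivrMr// => /le_trans; apply.
have -> : C1 + C2 * (1 + `|kappa| * ((e ^+ 2 / Phi e + (Phi 1)^-1) *
    (p.+1%:R * 2 ^+ p) ^+ (p.+1 * 2) * Phi a)) = C1 + C2 + C2 * C3 * Phi a.
  by rewrite /C3; ring.
rewrite mulrDl lerD2r (le_trans (ler_norm _))//.
rewrite -[leLHS](divfK (lt0r_neq0 Pe0)) ler_wpM2l ?divr_ge0 ?(ltW Pe0)//.
by apply: young_le Phi_sq _ (ltW ea).
Unshelve. all: by end_near. Qed.
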